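(* Let $n\ge0$ and let $x$ be a real number. Then $\rho_n(x)$ is expressed as a regular continued fraction $\rho_n(x)=[s_n;\boldsymbol{w}_n]$ (whenever both sides are defined), where $$s_n=\begin{cases}1&\text{if } n\text{ is even},\\ 1+x&\text{if } n\text{ is odd},\end{cases}$$ and the words $\boldsymbol{w}_n$ are defined recursively by: $\boldsymbol{w}_0=\boldsymbol{w}_1$ is the empty word and $$\boldsymbol{w}_n=[\boldsymbol{w}_{n-2},\,(-1)^nx,\,-\overleftarrow{\boldsymbol{w}_{n-2}},\,(-1)^nx,\,\boldsymbol{w}_{n-1}]\quad\text{for } n\ge2.$$ Moreover, the length of $\boldsymbol{w}_n$ is equal to $k_n$, and the continuants of $[s_n;\boldsymbol{w}_n]$ satisfy $p_{k_n}=H_n(x)$ and $q_{k_n}=H_{n-1}(x^2)$.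
   Context: A word is a finite sequence; $[\cdot,\cdot]$ denotes concatenation, $-\boldsymbol{w}$ is the word with all entries negated, $\overleftarrow{\boldsymbol{w}}$ is the reversed word. For $a_0$ and a word $\boldsymbol{w}=[a_1,\dots,a_l]$, $[a_0;\boldsymbol{w}]$ is the continued fraction $[a_0;a_1,\dots,a_l]=a_0+\cfrac{1}{a_1+\cfrac{1}{\ddots+\cfrac{1}{a_l}}}$, whose continuants are given by $p_{-1}=1$, $q_{-1}=0$, $p_0=a_0$, $q_0=1$, $p_j=a_jp_{j-1}+p_{j-2}$, $q_j=a_jq_{j-1}+q_{j-2}$ for $j\ge1$, so its value is $p_l/q_l$. $\rho_n$ is defined by $\rho_0(x)=1$ and $\rho_n(x)=1+\dfrac{x}{\rho_{n-1}(x^2)}$ for $n\ge1$, i.e. $\rho_n(x)=1+\cfrac{x}{1+\cfrac{x^2}{1+\cfrac{x^4}{\ddots+\cfrac{x^{2^{n-1}}}{1}}}}$. The integers $k_n$ are defined by $k_0=k_1=0$ and $k_n=2k_{n-2}+k_{n-1}+2$ for $n\ge2$. Let $H(q)=\sum_{m\ge0}c_mq^m$ be the unique power series with $H(0)=1$ and $H(q)=H(q^2)+qH(q^4)$; for $n\ge0$ put $H_n(x)=\sum_{m=0}^{2^n-1}c_mx^m$, and $H_n=1$ for $n<0$. *)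

(* Defs.v *)
From mathcomp Require Import all_boot all_order all_algebra.
From mathcomp Require Import reals.
From mathcomp Require Import zify.

Set Implicit Arguments.
Unset Strict Implicit.
Unset Printing Implicit Defensive.

Import Order.TTheory GRing.Theory Num.Theory.

Local Open Scope ring_scope.

Section Definitions.
Variable R : realType.
Implicit Types (x a : R) (w : seq R) (c : nat -> R) (n j m : nat).

(* [None] stands for an undefined quotient (zero divisor). *)
Definition pdiv a (b : option R) : option R :=
  if b is Some t then (if t == 0 then None else Some (a / t)) else None.

Fixpoint rho n x : option R :=
  if n is n1.+1 then omap (fun t => 1 + t) (pdiv x (rho n1 (x ^+ 2)))
  else Some 1.

(* The nested fraction a + 1/(w_0 + 1/(w_1 + ...)), undefined as soon as one
   of the nested denominators is zero. *)
Fixpoint cfrac a w : option R :=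
  if w is b :: w1 then omap (fun t => a + t) (pdiv 1 (cfrac b w1))
  else Some a.

(* The solution of u_j = a_j u_{j-1} + u_{j-2} (j >= 1) with u_{-1} = um1 and
   u_0 = u0; the partial quotient a_j is the entry of index j - 1 of w. *)
Fixpoint continuant_rec (um1 u0 : R) w j : R :=
  if j is j1.+1 then
    nth 0 w j1 * continuant_rec um1 u0 w j1
    + (if j1 is j2.+1 then continuant_rec um1 u0 w j2 else um1)
  else u0.

Definition cfrac_p a w j : R := continuant_rec 1 a w j.
Definition cfrac_q a w j : R := continuant_rec 0 1 w j.

Definition s_ n x : R := if odd n then 1 + x else 1.

Fixpoint w_ n x : seq R :=
  if n is n1.+1 then
    if n1 is n2.+1 then
      w_ n2 x ++ [:: (-1) ^+ n * x] ++ [seq - a | a <- rev (w_ n2 x)]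
        ++ [:: (-1) ^+ n * x] ++ w_ n1 x
    else [::]
  else [::].

(* A formal power series is represented by its sequence of coefficients:
   [ps_subst d c] is C(q^d) (for d > 0) and [ps_mulX c] is q C(q). *)
Definition ps_subst (d : nat) c m : R :=
  if (d %| m)%N then c (m %/ d)%N else 0.

Definition ps_mulX c m : R := if m is m1.+1 then c m1 else 0.

(* H(0) = 1 and H(q) = H(q^2) + q H(q^4) *)
Definition is_H c : Prop :=
  c 0%N = 1 /\ forall m, c m = ps_subst 2 c m + ps_mulX (ps_subst 4 c) m.

Definition Htrunc c (n : int) x : R :=
  if n is Posz n1 then \sum_(m < 2 ^ n1) c m * x ^+ m else 1.

End Definitions.

Fixpoint k_ (n : nat) : nat :=
  if n is n1.+1 then
    if n1 is n2.+1 then (2 * k_ n2 + k_ n1 + 2)%N else 0%N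
  else 0%N.

Lemma is_H_unique (R : realType) (c d : nat -> R) :
  is_H c -> is_H d -> c =1 d.
Proof.
move=> [c0 cE] [d0 dE]; elim/ltn_ind => -[|m] IH; first by rewrite c0 d0.
rewrite cE dE /ps_mulX /ps_subst; congr (_ + _).
  by case: ifP => // _; apply: IH; lia.
by case: ifP => // _; apply: IH; lia.
Qed.

Lemma is_H_exists (R : realType) : exists c : nat -> R, is_H c.
Proof.
pose fix f (k m : nat) {struct k} : R := if m == 0%N then 1 else
  if k is k1.+1 then ps_subst 2 (f k1) m + ps_mulX (ps_subst 4 (f k1)) m
  else 0.
have f0 k : f k 0%N = 1 by case: k.
have fE k l m : (m <= k)%N -> (m <= l)%N -> f k m = f l m.
  elim: k l m => [|k IH] [|l] [|m] //= mk ml.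
  rewrite /ps_subst; congr (_ + _); case: ifP => // _; apply: IH; lia.
exists (fun m => f m m); split=> // -[|m].
  by rewrite /ps_subst /= addr0.
rewrite [LHS]/= /ps_mulX /ps_subst.
by congr (_ + _); case: ifP => // _; apply: fE; lia.
Qed.

(* Main.v *)
Require Import Defs.
From mathcomp Require Import all_boot all_order all_algebra.
From mathcomp Require Import reals.
From mathcomp Require Import zify ring.

(** The function rho_n is itself a finite continued fraction, with partial
numerators x, x^2, x^4, ..., whose successive numerators are the truncations
of H; the point is that the regular continued fraction [s_n; w_n] has the same
numerator and denominator.

Cutting H(q) = H(q^2) + q H(q^4) at degree 2^n gives
H_n(x) = H_(n-1)(x^2) + x H_(n-2)(x^4).  It is convenient to start this
recursion two steps earlier, from the values 0 and 1: [hpoly] below is the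
resulting sequence, with [hpoly n.+2 = H_n] ([Htrunc_hpoly]).  Dividing the
recursion by H_(n-1)(x^2) yields rho_n(x) = H_n(x) / H_(n-1)(x^2)
([rho_hpoly]).

The continuants of a word w are read off the product of the matrices
(a 1; 1 0) for a in w ([cfmx], [continuant_rec_cfmx], [cfrac_cfmx]).  These
matrices are symmetric, so reversing a word transposes the product, and
negating a word of even length only flips the signs of the off-diagonal
entries.  Hence the folded word w, t, -rev w, t, v has a matrix whose first
column depends only on t and on the first columns of w and v, because the other
entries of w occur only in its determinant, which is 1 ([cfmx_fold]).  The
denominator H_(n-1)(x^2) of [s_n; w_n] then follows by induction on n
([cfmx_w]) from two identities for H_n.  One is the determinant formula
([hpoly_det])
H_(j-1)(y) H_(j-1)(y^2) - H_(j-2)(y^2) H_j(y) = (-1)^j y^(2^j - 1)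
between consecutive convergents of rho; the other is the mirror form
([hpoly_mirror]) H_n(y) = H_(n-1)(y) + y^(2^(n-1)) H_(n-2)(y) of the recursion,
in which the block of highest exponents is split off instead of the odd ones. *)

Set Implicit Arguments.
Unset Strict Implicit.

Import Order.TTheory GRing.Theory Num.Theory.

Local Open Scope ring_scope.

(** * Matrices of continued fractions *)

Section ContinuantMatrix.
Variable R : comNzRingType.
Implicit Types (a t : R) (w v : seq R).

Definition pqmx a : 'M[R]_2 :=
  \matrix_(i, j) (if i == 0 then if j == 0 then a else 1 else (j == 0)%:R).

Definition cfmx w : 'M[R]_2 := \prod_(a <- w) pqmx a.

Lemma mulmx2E (A B : 'M[R]_2) i j :
  (A *m B) i j = A i 0 * B 0 j + A i 1 * B 1 j.
Proof.
rewrite mxE !big_ord_recl big_ord0 addr0.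
by congr (A _ _ * B _ _ + A _ _ * B _ _); apply: val_inj.
Qed.

Lemma cfmx_cat w v : cfmx (w ++ v) = cfmx w *m cfmx v.
Proof. by rewrite /cfmx big_cat. Qed.

Lemma cfmx_cons0 a w j : cfmx (a :: w) 0 j = a * cfmx w 0 j + cfmx w 1 j.
Proof. by rewrite /cfmx big_cons [LHS]mulmx2E !mxE /= mul1r. Qed.

Lemma cfmx_cons1 a w j : cfmx (a :: w) 1 j = cfmx w 0 j.
Proof. by rewrite /cfmx big_cons [LHS]mulmx2E !mxE /= mul1r mul0r addr0. Qed.

Lemma cfmx_rev w : cfmx (rev w) = (cfmx w)^T.
Proof.
elim: w => [|a w IH]; first by rewrite /cfmx big_nil trmx1.
rewrite rev_cons -cats1 -[in RHS]cat1s !cfmx_cat IH trmx_mul.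
congr (_ *m _); apply/matrixP => i j; rewrite /cfmx big_seq1 !mxE.
by case: (i == 0); case: (j == 0).
Qed.

Lemma cfmx_opp w i j :
  cfmx [seq - a | a <- w] i j = (-1) ^+ (size w + i + j) * cfmx w i j.
Proof.
elim: w i j => [|a w IH] i j.
  rewrite /cfmx big_nil mxE; case: eqP => [->|_]; last by rewrite mulr0.
  by rewrite add0n addnn -mul2n exprM sqrrN expr1n expr1n mulr1.
have [->|->] : i = 0 \/ i = 1.
  by case: i => [[|[|?]] ?] //; [left | right]; apply: val_inj.
  rewrite [map _ _]/= !cfmx_cons0 !IH /= !addn0 addn1 !addSn !exprS; ring.
rewrite [map _ _]/= !cfmx_cons1 IH /= !addn0 addn1 !addSn !exprS; ring.
Qed.

Lemma det_cfmx w :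
  cfmx w 0 0 * cfmx w 1 1 - cfmx w 0 1 * cfmx w 1 0 = (-1) ^+ size w.
Proof.
elim: w => [|a w IH]; first by rewrite /cfmx big_nil !mxE /= mulr1 mulr0 subr0.
rewrite !cfmx_cons0 !cfmx_cons1 exprS -IH; ring.
Qed.

(** In the product, the second column of [cfmx w] survives only through the
determinant, which is 1 since [w] has even length. *)
Lemma cfmx_fold w v t :
  let a := cfmx w 0 0 in let c := cfmx w 1 0 in
  let a' := cfmx v 0 0 in let c' := cfmx v 1 0 in
  let u := w ++ [:: t] ++ [seq - b | b <- rev w] ++ [:: t] ++ v in
  ~~ odd (size w) ->
  cfmx u 0 0 = a' + t * a * ((t * a - c) * a' + a * c') /\
  cfmx u 1 0 = t * a' + c' + t * c * ((t * a - c) * a' + a * c').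
Proof.
move=> a c a' c' u w_even; have := det_cfmx w.
rewrite /u !cfmx_cat !mulmx2E !cfmx_cons0 !cfmx_cons1 !cfmx_opp.
rewrite cfmx_rev size_rev ![_^T _ _]mxE.
rewrite /cfmx big_nil !mxE /= -/(cfmx w) -/(cfmx v) -/a -/c -/a' -/c'.
rewrite !addn0 -addnA !exprD -signr_odd (negbTE w_even) expr0 expr1 !mul1r.
set b := cfmx w 0 1; set d := cfmx w 1 1 => det1.
have det1' : a * d = 1 + b * c by rewrite -det1 subrK.
split; ring: det1'.
Qed.

End ContinuantMatrix.

Section Evaluation.
Variable R : realType.
Implicit Types (a x : R) (w : seq R).

Lemma continuant_rec_cons (u u' b : R) w j :
  continuant_rec u u' (b :: w) j.+1 = continuant_rec u' (b * u' + u) w j.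
Proof.
elim/ltn_ind: j => -[|[|j]] IH //.
transitivity (nth 0 w j.+1 * continuant_rec u u' (b :: w) j.+2
  + continuant_rec u u' (b :: w) j.+1) => //.
by rewrite !IH.
Qed.

(** The recurrence multiplies the row vector (u_(j-1), u_(j-2)) on the right by
the matrix of a_j, so that [cfmx w] takes (u_0, u_(-1)) to its last value. *)
Lemma continuant_rec_cfmx (u u' : R) w :
  continuant_rec u u' w (size w) = u' * cfmx w 0 0 + u * cfmx w 1 0.
Proof.
elim: w u u' => [|b w IH] u u'.
  by rewrite /cfmx big_nil !mxE /= mulr1 mulr0 addr0.
rewrite [size _]/= continuant_rec_cons IH cfmx_cons0 cfmx_cons1; ring.
Qed.

(** The denominator of a nested fraction is the numerator of the next inner one,
which is nonzero as soon as the nested fraction can be evaluated. *)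
Lemma cfrac_cfmx a w v : cfrac a w = Some v ->
  cfmx w 0 0 != 0 /\ v = (a * cfmx w 0 0 + cfmx w 1 0) / cfmx w 0 0.
Proof.
elim: w a v => [|b w IH] a v /=.
  by case=> <-; rewrite /cfmx big_nil !mxE /= mulr1 addr0 divr1 oner_eq0.
case E: cfrac => [t|] //=; have [w0 tE] := IH _ _ E.
case: eqP => //= /eqP t0 [<-].
rewrite cfmx_cons0 cfmx_cons1.
have num0 : b * cfmx w 0 0 + cfmx w 1 0 != 0.
  by apply: contraNneq t0 => num0; rewrite tE num0 mul0r.
by split=> //; rewrite tE; field; rewrite w0 num0.
Qed.

End Evaluation.

(** * The truncations of H *)

Section TruncationRecursion.
Variable R : comNzRingType.
Implicit Types x y : R.

(** The initial value 0 differs from H_(-2) = 1: with it the recursion, and the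
identities below, already hold at the first index. *)
Fixpoint hpoly (n : nat) y : R :=
  if n is n1.+1 then
    if n1 is n2.+1 then hpoly n1 (y ^+ 2) + y * hpoly n2 (y ^+ 4) else 1
  else 0.

Lemma hpolySS n y :
  hpoly n.+2 y = hpoly n.+1 (y ^+ 2) + y * hpoly n (y ^+ 4).
Proof. by []. Qed.

(** As for all continued fractions, this is up to sign the product of the
partial numerators y, y^2, y^4, ..., y^(2^(n-1)). *)
Lemma hpoly_det n y :
  hpoly n.+1 y * hpoly n.+1 (y ^+ 2) - hpoly n (y ^+ 2) * hpoly n.+2 y
  = (-1) ^+ n * y ^+ (2 ^ n - 1).
Proof.
elim: n y => [|n IH] y; first by rewrite /= mul0r subr0 !mulr1.
have expE : (2 ^ n.+1 - 1 = 1 + 2 * (2 ^ n - 1))%N.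
  by rewrite expnS; have := expn_gt0 2 n; lia.
have := IH (y ^+ 2); rewrite -!exprM => IHy.
rewrite expE exprD expr1 (exprS (-1)) -mulrA (mulrCA _ y) -IHy.
by rewrite (hpolySS n y) (hpolySS n.+1 y); ring.
Qed.

(** The identity is preserved by the recursion because the powers of y that it
produces in the two terms agree, (y^2)^(2^(n-2)) = (y^4)^(2^(n-3)).  Both sides
are taken at y^2 so that the exponent, 2^(n-1) for the variable y^2, also makes
sense for [n = 0]. *)
Lemma hpoly_mirror n y :
  hpoly n.+2 (y ^+ 2) = hpoly n.+1 (y ^+ 2) + y ^+ (2 ^ n) * hpoly n (y ^+ 2).
Proof.
elim/ltn_ind: n y => -[|[|n]] IH y; [by rewrite /= !mulr0 | | ].
  by rewrite expn1 /=; ring.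
have e1 := IH n.+1 (leqnn _) (y ^+ 2).
have e2 := IH n (leqW (leqnn _)) (y ^+ 4); rewrite !(exprAC y 4 2) in e2.
rewrite !(hpolySS _ (y ^+ 2)) {}e1 {}e2 -!exprM.
have -> : (2 ^ n.+2 = 2 * 2 ^ n.+1)%N by rewrite expnS.
have -> : (4 * 2 ^ n = 2 * 2 ^ n.+1)%N by rewrite expnS; lia.
ring.
Qed.

(** Only the exponents divisible by [d] contribute, so truncating C(q^d) at
degree dN is the same as truncating C at degree N. *)
Lemma sum_multiples (c : nat -> R) d N x : (0 < d)%N ->
  \sum_(m < d * N) (if (d %| m)%N then c (m %/ d)%N else 0) * x ^+ m
  = \sum_(m < N) c m * (x ^+ d) ^+ m.
Proof.
case: d => // d _; elim: N => [|N IH]; first by rewrite muln0 !big_ord0.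
rewrite mulnSr big_split_ord /= IH [in RHS]big_ord_recr /=; congr (_ + _).
rewrite big_ord_recl big1 => [|i _] /=.
  by rewrite addn0 dvdn_mulr // mulKn // addr0 exprM.
by rewrite /bump /= dvdn_addr ?dvdn_mulr // gtnNdvd ?mul0r //= ltnS ltn_ord.
Qed.

End TruncationRecursion.

Section Truncation.
Variables (R : realType) (c : nat -> R).
Hypothesis hc : is_H c.

Lemma sum_mulX_subst4 N (x : R) :
  \sum_(m < 4 * N) ps_mulX (ps_subst 4 c) m * x ^+ m
  = x * \sum_(m < N) c m * (x ^+ 4) ^+ m.
Proof.
case: N => [|N]; first by rewrite !big_ord0 mulr0.
rewrite -sum_multiples //.
have -> : (4 * N.+1 = (4 * N + 3).+1)%N by lia.
(* The shift by q drops the last exponent 4 * N + 3, which carries no term. *)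
rewrite big_ord_recl /= mul0r add0r [in RHS]big_ord_recr /=.
rewrite dvdn_addr ?dvdn_mulr //= mul0r addr0 mulr_sumr.
by apply: eq_bigr => i _; rewrite /bump /= add1n exprS mulrCA.
Qed.

Lemma Htrunc_hpoly n x : Htrunc c (Posz n) x = hpoly n.+2 x.
Proof.
case: hc => c0 cE; have c1 : c 1%N = 1.
  by rewrite cE /ps_mulX /ps_subst /= add0r.
elim/ltn_ind: n x => -[|[|n]] IH x.
- by rewrite /Htrunc big_ord_recl big_ord0 /= c0; ring.
- rewrite /Htrunc !big_ord_recl big_ord0 /= c0 /bump /= c1; ring.
rewrite hpolySS -!IH // /Htrunc.
under eq_bigr => m _ do rewrite cE mulrDl.
rewrite big_split /=; congr (_ + _).
  by rewrite [in LHS]expnS sum_multiples.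
by rewrite !expnS mulnA sum_mulX_subst4.
Qed.

Lemma Htrunc_pred_hpoly n x : Htrunc c (Posz n - 1) x = hpoly n.+1 x.
Proof. by case: n => [|n] //; rewrite -Htrunc_hpoly; congr Htrunc; lia. Qed.

End Truncation.

(** * The word w_n and the function rho_n *)

Section Words.
Variable R : realType.
Implicit Type x : R.

Lemma w_SS n x : w_ n.+2 x =
  w_ n x ++ [:: (-1) ^+ n * x] ++ [seq - a | a <- rev (w_ n x)]
    ++ [:: (-1) ^+ n * x] ++ w_ n.+1 x.
Proof.
rewrite -[in RHS]signr_odd -[odd n]negbK -[~~ ~~ _]/(odd n.+2).
by rewrite signr_odd.
Qed.

Lemma size_w n x : size (w_ n x) = k_ n.
Proof.
elim/ltn_ind: n => -[|[|n]] IH //.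
rewrite w_SS !size_cat size_map size_rev !IH //=; lia.
Qed.

Lemma odd_k n : odd (k_ n) = false.
Proof.
elim/ltn_ind: n => -[|[|n]] IH //.
by rewrite -[k_ _]/(2 * k_ n + k_ n.+1 + 2)%N 2!oddD oddM !IH.
Qed.

(** The second entry is what remains of the numerator H_n(x) once s_n times the
denominator H_(n-1)(x^2) is taken away. *)
Lemma cfmx_w n x :
  cfmx (w_ n x) 0 0 = hpoly n.+1 (x ^+ 2) /\
  cfmx (w_ n x) 1 0 =
    x * hpoly n (x ^+ 4) - (odd n)%:R * x * hpoly n.+1 (x ^+ 2).
Proof.
elim/ltn_ind: n => -[|[|n]] IH.
- by rewrite /cfmx big_nil !mxE /=; split; ring.
- by rewrite /cfmx big_nil !mxE /=; split; ring.
have [a0 c0] := IH n (leqW (leqnn _)); have [a1 c1] := IH n.+1 (leqnn _).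
have w_even : ~~ odd (size (w_ n x)) by rewrite size_w odd_k.
have [] := @cfmx_fold R (w_ n x) (w_ n.+1 x) ((-1) ^+ n * x) w_even.
rewrite -w_SS => -> ->; rewrite a0 c0 a1 c1.
have det := hpoly_det n (x ^+ 2).
have mir2 := hpoly_mirror n.+1 x; have mir4 := hpoly_mirror n (x ^+ 2).
rewrite -!exprM in det mir2 mir4.
have pE : x ^+ (2 * 2 ^ n) = x ^+ 2 * x ^+ (2 * (2 ^ n - 1)).
  by rewrite -exprD; congr (x ^+ _); have := expn_gt0 2 n; lia.
rewrite expnS pE in mir2; rewrite pE in mir4.
rewrite {}mir2 {}mir4 -[odd n.+2]/(~~ ~~ odd n) -[odd n.+1]/(~~ odd n) negbK.
rewrite -signr_odd in det; rewrite -signr_odd.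
change (2 * 2)%N with 4%N in det |- *.
move: (hpoly n.+1 (x ^+ 2)) (hpoly n.+1 (x ^+ 4)) (hpoly n.+2 (x ^+ 2))
  (hpoly n (x ^+ 4)) (x ^+ (2 * (2 ^ n - 1))) det => A E B C p.
(* Once the power p is replaced by its value, up to sign, as a determinant, both
claims are identities between polynomials in A, B, C, E and x. *)
case: (odd n).
  rewrite expr1 mulN1r => /eqP; rewrite -eqr_oppLR => /eqP <-.
  by split; rewrite /=; ring.
by rewrite expr0 mul1r => <-; split; rewrite /=; ring.
Qed.

(** The numerator of rho_(n-1)(x^2) is the denominator of rho_n(x); it is
nonzero because rho_n(x) is defined only if rho_(n-1)(x^2) is nonzero. *)
Lemma rho_hpoly n x u : rho n x = Some u ->
  hpoly n.+1 (x ^+ 2) != 0 /\ u = hpoly n.+2 x / hpoly n.+1 (x ^+ 2).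
Proof.
elim: n x u => [|n IH] x u.
  by case=> <-; rewrite hpolySS /= mulr0 addr0 divr1 oner_eq0.
have {IH} := IH (x ^+ 2); rewrite -exprM (hpolySS n.+1 x) [rho n.+1 x]/=.
move: (hpoly n.+2 (x ^+ 2)) (hpoly n.+1 (x ^+ 4)) => N D IH.
case E: rho => [t|] //=; case: eqP => //= /eqP t0 [<-].
have [D0 tE] := IH _ E.
have N0 : N != 0 by apply: contraNneq t0 => N0; rewrite tE N0 mul0r.
by split=> //; rewrite tE; field; rewrite N0 D0.
Qed.

Lemma cfrac_num_hpoly n x :
  s_ n x * cfmx (w_ n x) 0 0 + cfmx (w_ n x) 1 0 = hpoly n.+2 x.
Proof.
have [-> ->] := cfmx_w n x; rewrite hpolySS /s_.
by case: (odd n); rewrite ?mulr1n ?mulr0n; ring.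
Qed.

End Words.

Theorem theorem2p2p4 (R : realType) (c : nat -> R) (hc : is_H c)
    (n : nat) (x : R) :
  [/\ forall u v : R,
        rho n x = Some u -> cfrac (s_ n x) (w_ n x) = Some v -> u = v,
      forall u : R,
        rho n x = Some u -> cfrac_q (s_ n x) (w_ n x) (k_ n) != 0 ->
        u = cfrac_p (s_ n x) (w_ n x) (k_ n)
            / cfrac_q (s_ n x) (w_ n x) (k_ n),
      size (w_ n x) = k_ n,
      cfrac_p (s_ n x) (w_ n x) (k_ n) = Htrunc c (Posz n) x
    & cfrac_q (s_ n x) (w_ n x) (k_ n) = Htrunc c (Posz n - 1) (x ^+ 2)].
Proof.
have [q_w _] := cfmx_w n x.
have pE : cfrac_p (s_ n x) (w_ n x) (k_ n) = hpoly n.+2 x.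
  by rewrite /cfrac_p -(size_w n x) continuant_rec_cfmx mul1r cfrac_num_hpoly.
have qE : cfrac_q (s_ n x) (w_ n x) (k_ n) = hpoly n.+1 (x ^+ 2).
  by rewrite /cfrac_q -(size_w n x) continuant_rec_cfmx mul1r mul0r addr0.
rewrite pE qE Htrunc_hpoly // Htrunc_pred_hpoly //; split=> //.
- move=> u v /rho_hpoly [_ ->] /cfrac_cfmx [_ ->].
  by rewrite cfrac_num_hpoly q_w.
- by move=> u /rho_hpoly [_ ->].
- exact: size_w.
Qed.
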